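(* Let $f(Z_1,\ldots,Z_k)=\det(Z)^\gamma\sum_{\beta\in B}c_\beta\det(Z)^\beta=\det(Z)^\gamma\tilde f(Z)$ be a psd-stable polynomial of determinants in standard form. Then any block $Z_i$ appearing in $\tilde f$ (that is, any $Z_i$ such that there is $\beta\in B$ with $\beta_i>0$) has size $d_i\le 2$. Further, for any block $Z_i$ which has size exactly $2$, let $C_i=\max_{\beta\in B}\beta_i$. Then, if $\beta\in B$, also $\beta+c\,\mathbf{e}_i\in B$ for all integers $c$ with $-\beta_i\le c\le C_i-\beta_i$.
   Context: $Z$ is a symmetric block diagonal matrix of variables with diagonal blocks $Z_1,\dots,Z_k$, where $Z_i$ is a symmetric $d_i\times d_i$ matrix of variables (entries in positions $(p,q)$ and $(q,p)$ of a block are identified; otherwise all variables are distinct). For $\alpha\in\mathbb{Z}_{\ge 0}^k$ put $\det(Z)^\alpha=\det(Z_1)^{\alpha_1}\cdots\det(Z_k)^{\alpha_k}$. A polynomial of determinants is a polynomial of the form $f(Z_1,\dots,Z_k)=\sum_\alpha c_\alpha\det(Z)^\alpha$ (finite sum, $c_\alpha\in\mathbb{C}$). It is written in standard form if the largest possible determinantal monomial is factored out, i.e. $f=\det(Z)^\gamma\sum_{\beta\in B}c_\beta\det(Z)^\beta$ with $\gamma\in\mathbb{Z}_{\ge0}^k$, $B\subset\mathbb{Z}^k_{\ge 0}$ finite, all $c_\beta\ne 0$, and $\min_{\beta\in B}\beta_i=0$ for each $i$. Such an $f$ is psd-stable if $f(M)\ne0$ for every complex symmetric matrix $M$ of this block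 diagonal form whose entrywise imaginary part is positive definite. $\mathbf{e}_i$ is the $i$-th unit vector in $\mathbb{R}^k$. *)

(* Defs.v *)
From HB Require Import structures.
From mathcomp Require Import all_boot all_order all_algebra finmap.
From mathcomp Require Import reals complex mpoly.

Set Implicit Arguments.
Unset Strict Implicit.
Unset Printing Implicit Defensive.

Import Order.TTheory GRing.Theory Num.Theory.
Local Open Scope ring_scope.

(* One variable for each block i and each position (p, q) of that block with  *)
(* p <= q; the positions (p, q) and (q, p) share a variable.                  *)
Definition is_upper k (d : 'I_k -> nat) :
    pred {i : 'I_k & ('I_(d i) * 'I_(d i))%type} :=
  fun x => ((tagged x).1 <= (tagged x).2)%N.

Definition entry k (d : 'I_k -> nat) := {x | @is_upper k d x}.

Lemma upper_posP k (d : 'I_k -> nat) (i : 'I_k) (p q : 'I_(d i)) :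
  @is_upper k d (Tagged (fun i => 'I_(d i) * 'I_(d i))%type
                        (if (p <= q)%N then (p, q) else (q, p))).
Proof. by rewrite /is_upper /=; case: (leqP p q) => //= /ltnW. Qed.

Definition entry_of k (d : 'I_k -> nat) (i : 'I_k) (p q : 'I_(d i)) : entry d :=
  exist (@is_upper k d) _ (upper_posP p q).

Section PolynomialsOfDeterminants.
Context (R : realType) (k : nat) (d : 'I_k -> nat).

Notation C := R[i].
Notation zpoly := {mpoly C[#|{: entry d}|]}.

Definition Zblock (i : 'I_k) : 'M[zpoly]_(d i) :=
  \matrix_(p, q) 'X_(enum_rank (entry_of p q)).

Definition det_monomial (a : {ffun 'I_k -> nat}) : zpoly :=
  \prod_(i < k) \det (Zblock i) ^+ a i.

Definition det_poly (g : {ffun 'I_k -> nat}) (B : {fset {ffun 'I_k -> nat}})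
    (c : {ffun 'I_k -> nat} -> C) : zpoly :=
  det_monomial g * \sum_(b <- B) c b *: det_monomial b.

(* The n-th variable is sent to the entry of M at the position that it        *)
(* encodes; only the upper triangles of the blocks are read.                  *)
Definition block_values (M : forall i : 'I_k, 'M[C]_(d i)) :
    'I_#|{: entry d}| -> C :=
  fun n => let x := val (enum_val n) in M (tag x) (tagged x).1 (tagged x).2.

Definition eval_blocks (f : zpoly) (M : forall i : 'I_k, 'M[C]_(d i)) : C :=
  f.@[block_values M].

Definition posdefmx n (A : 'M[R]_n) : Prop :=
  A^T = A /\ forall x : 'cV[R]_n, x != 0 -> 0 < (x^T *m A *m x) 0 0.

Definition psd_stable (f : zpoly) : Prop :=
  forall M : (forall i : 'I_k, 'M[C]_(d i)),
    (\mxdiag_i M i)^T = \mxdiag_i M i ->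
    posdefmx (map_mx (@complex.Im R) (\mxdiag_i M i)) ->
    eval_blocks f M != 0.

(* Since exponents are natural numbers, min_{b in B} b_i = 0 says that the    *)
(* value 0 is attained.                                                       *)
Definition standard_form (B : {fset {ffun 'I_k -> nat}})
    (c : {ffun 'I_k -> nat} -> C) : Prop :=
  (forall b, b \in B -> c b != 0) /\
  (forall i : 'I_k, exists2 b, b \in B & b i = 0%N).

End PolynomialsOfDeterminants.

Lemma tr_Zblock (R : realType) k (d : 'I_k -> nat) (i : 'I_k) :
  (Zblock R d i)^T = Zblock R d i.
Proof.
apply/matrixP => p q; rewrite !mxE; congr 'X_(enum_rank _).
apply/val_inj => /=; congr Tagged.
by case: (ltngtP p q) => // /val_inj ->.
Qed.

Lemma eval_Zblock (R : realType) k (d : 'I_k -> nat)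
    (M : forall i : 'I_k, 'M[R[i]]_(d i)) (i : 'I_k) (p q : 'I_(d i)) :
  (M i)^T = M i -> eval_blocks (Zblock R d i p q) M = M i p q.
Proof.
move=> symM; rewrite /eval_blocks mxE mevalXU /block_values enum_rankK /=.
by case: ifP => //= _; rewrite -[in RHS]symM mxE.
Qed.

Lemma eval_det_poly (R : realType) k (d : 'I_k -> nat)
    (g : {ffun 'I_k -> nat}) (B : {fset {ffun 'I_k -> nat}})
    (c : {ffun 'I_k -> nat} -> R[i]) (M : forall i : 'I_k, 'M[R[i]]_(d i)) :
  (forall i, (M i)^T = M i) ->
  eval_blocks (det_poly d g B c) M =
    (\prod_(i < k) \det (M i) ^+ g i) *
    \sum_(b <- B) c b * \prod_(i < k) \det (M i) ^+ b i.
Proof.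
move=> symM; rewrite /eval_blocks /det_poly; set v := block_values M.
have evalM a : (det_monomial R d a).@[v] = \prod_(i < k) \det (M i) ^+ a i.
  rewrite /det_monomial rmorph_prod; apply: eq_bigr => i _.
  rewrite rmorphXn /= -det_map_mx; congr (\det _ ^+ _).
  by apply/matrixP => p q; rewrite mxE; exact: eval_Zblock.
rewrite mevalM evalM raddf_sum; congr (_ * _).
by apply: eq_bigr => b _ /=; rewrite mevalZ evalM.
Qed.

(* Main.v *)
(* Symmetric matrices with positive definite imaginary part realize as        *)
(* determinants: an open half plane (up to rotation) for every block, all of  *)
(* C minus [0, +oo) for a block of size 2, and all of C^* for size >= 3.      *)
(* Fix the other determinants z and view f~ as a polynomial in x = det Z_i    *)
(* with coefficients F_n(z).  If d_i >= 3 it has no nonzero root, so          *)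
(* F_0 F_n = 0 for n > 0, and F_0 <> 0 in standard form.  If d_i = 2 all its  *)
(* roots are nonnegative reals, so F_0(z) * conj F_n(z) is real on an open    *)
(* set of z; hence F_n = lambda_n F_0 with constant lambda_n, nonzero for     *)
(* n <= C_i since a polynomial with positive roots has no vanishing           *)
(* coefficient.  So B is the product of a slice with {0, ..., C_i}.           *)

Require Import Defs.
From HB Require Import structures.
From mathcomp Require Import all_boot all_order all_algebra finmap.
From mathcomp Require Import reals complex ring lra zify.

Set Implicit Arguments.
Unset Strict Implicit.
Unset Printing Implicit Defensive.

Import Order.TTheory GRing.Theory Num.Theory.
Local Open Scope ring_scope.

(** Diagonal blocks suffice as test matrices: by [psd_stable_neq0] the reduced sum has no zero at
    tuples of [upper_product] values. With the other determinants z fixed, [slice_poly] is a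
    polynomial in x = det Z_i with coefficients F_n(z), and [root_slice_poly] restricts its roots.

    The restriction only gives facts pointwise in z: F_0 * conj F_n vanishes (size at least 3,
    [block_size_le2]) or is real (size 2, [slice_real]). They become facts about coefficients
    through [conj_form_eq0], the independence of monomials in z and conj z. Conjugating one factor
    keeps the two exponents apart, so each coefficient of the product is a single c_b * conj c_b',
    without cancellation. For size 2 this yields [slice_coef_proportional], and [with_exp_mem]
    concludes because coefficients up to the degree do not vanish. *)

Lemma posdefmx_diag (R : realType) n (A : 'M[R]_n) :
  is_diag_mx A -> (forall s, 0 < A s s) -> posdefmx A.
Proof.
case/diag_mxP=> D -> Dgt0; split; first exact: tr_diag_mx.
have {}Dgt0 s : 0 < D 0 s by have := Dgt0 s; rewrite mxE eqxx.
have quadE (x : 'cV[R]_n) :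
    (x^T *m diag_mx D *m x) 0 0 = \sum_s D 0 s * x s 0 ^+ 2.
  rewrite mul_mx_diag mxE; apply: eq_bigr => s _.
  by rewrite !mxE mulrAC mulrC expr2.
move=> x x_neq0; rewrite quadE lt_def sumr_ge0; last first.
  by move=> s _; rewrite mulr_ge0 ?sqr_ge0 // ltW.
rewrite andbT; apply: contra_neq x_neq0 => sum0; apply/colP => s; rewrite mxE.
have /(psumr_eq0P _)/(_ s isT)/eqP := sum0; rewrite mulf_eq0 gt_eqF //= sqrf_eq0.
by move=> /(_ _)/eqP -> // t _; rewrite mulr_ge0 ?sqr_ge0 // ltW.
Qed.

(** * Independence of monomials in z and conj z on grids *)

(** A polynomial with infinitely many roots is zero; terms sharing an exponent are grouped. *)
Lemma vanishing_coef (F : fieldType) (T : Type) (s : seq T) (P : pred T)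
    (a : T -> F) (e : T -> nat) (g : nat -> F) :
  injective g -> (forall n, \sum_(t <- s | P t) a t * g n ^+ e t = 0) ->
  forall m, \sum_(t <- s | P t && (e t == m)) a t = 0.
Proof.
move=> g_inj sum0 m; pose p := \sum_(t <- s | P t) a t *: 'X^(e t).
have p0 : p = 0.
  apply: (@roots_geq_poly_eq0 _ _ [seq g n | n <- iota 0 (size p)]).
  - apply/allP => _ /mapP [n _ ->]; apply/eqP; rewrite horner_sum -[RHS](sum0 n).
    by apply: eq_bigr => t _; rewrite hornerZ hornerXn.
  - by rewrite map_inj_uniq ?iota_uniq.
  - by rewrite size_map size_iota.
have := coef0 F m; rewrite -p0 coef_sum => {2}<-.
rewrite big_mkcondr; apply: eq_bigr => t _; rewrite coefZ coefXn eq_sym.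
by case: eqP; rewrite ?mulr1 ?mulr0.
Qed.

Section ConjugatePolynomials.
Context (R : realType).
Notation C := R[i].

Lemma conjCM (x y : C) : (x * y)^* = x^* * y^*.
Proof. exact: rmorphM. Qed.

(** A grid in the upper half plane rotated by [rho]: [n] selects the direction, [r] the positive
    scale. *)
Definition halfplane_point (rho : C) n r : C := rho * (r.+1%:R * (n%:R +i* 1)%C).

(* In polar form z = r v the monomial z^m1 (z^* )^m2 is r^(m1+m2) times        *)
(* (v^* )^(m1+m2) (v/v^* )^m1: the radius r isolates m1 + m2, then the        *)
(* direction v isolates m1.                                                   *)
Lemma vanishing_coef_conj (rho : C) (T : Type) (s : seq T) (P : pred T)
    (a : T -> C) (e1 e2 : T -> nat) :
  rho != 0 ->
  (forall n r (z := halfplane_point rho n r),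
     \sum_(t <- s | P t) a t * (z ^+ e1 t * z^* ^+ e2 t) = 0) ->
  forall m1 m2,
    \sum_(t <- s | P t && ((e1 t == m1) && (e2 t == m2))) a t = 0.
Proof.
move=> rho0 sum0 m1 m2.
pose v n : C := rho * (n%:R +i* 1)%C.
have v0 n : v n != 0 by rewrite mulf_neq0 // eq_complex /= oner_eq0 andbF.
have vJ0 n : (v n)^* != 0 by rewrite conjC_eq0.
have radial n : \sum_(t <- s | P t && (e1 t + e2 t == m1 + m2)%N)
    a t * (v n ^+ e1 t * (v n)^* ^+ e2 t) = 0.
  apply: (vanishing_coef (g := fun r => r.+1%:R)).
    by move=> r r' /eqP; rewrite eqr_nat eqSS => /eqP.
  move=> r; rewrite -[RHS](sum0 n r); apply: eq_bigr => t _.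
  have -> : halfplane_point rho n r = r.+1%:R * v n by rewrite mulrCA.
  rewrite (conjCM _ (v n)) conjC_nat; move: (v n)^* (v n) => wJ w.
  by rewrite !exprMn exprD -mulrA [in RHS]mulrACA; congr (_ * _); exact: mulrC.
have angular n : \sum_(t <- s | P t && (e1 t + e2 t == m1 + m2)%N)
    a t * (v n / (v n)^*) ^+ e1 t = 0.
  apply: (mulIf (expf_neq0 (m1 + m2) (vJ0 n))).
  rewrite mul0r -[RHS](radial n) big_distrl; apply: eq_bigr => t /andP[_ /eqP <-].
  by rewrite /= -mulrA exprD [X in _ * X = _]mulrA -exprMn divfK.
(* The factor [rho] over its conjugate cancels, and (n + i) / (n - i) determines n. *)
have ratio_inj : injective (fun n => v n / (v n)^*).
  move=> n n' /= /eqP; rewrite eqr_div //.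
  rewrite !(conjCM rho) ![_ * _ * (rho^* * _)]mulrACA => /eqP.
  move/(mulfI (mulf_neq0 rho0 _)); rewrite conjC_eq0 => /(_ rho0) /= -[_].
  rewrite !mulrN1 !mul1r => eq_nn'.
  by apply/eqP; rewrite -(eqr_nat R); apply/eqP; lra.
have := vanishing_coef ratio_inj angular m1; congr (_ = 0).
apply: eq_bigl => t; rewrite -andbA; congr (_ && _).
by rewrite andbC; case: eqP => //= ->; rewrite eqn_add2l.
Qed.

Lemma vanishing_coef_conj_prod (I : eqType) (rho : I -> C) (T : Type)
    (s : seq T) (e1 e2 : T -> I -> nat) (J : seq I) (P : pred T) (a : T -> C) :
  (forall i, rho i != 0) -> uniq J ->
  (forall n r (z := fun i => halfplane_point (rho i) (n i) (r i)),
     \sum_(t <- s | P t)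
       a t * \prod_(i <- J) (z i ^+ e1 t i * (z i)^* ^+ e2 t i) = 0) ->
  forall m1 m2, \sum_(t <- s | P t &&
    all (fun i => (e1 t i == m1 i) && (e2 t i == m2 i)) J) a t = 0.
Proof.
move=> rho0 uniqJ sum0 m1 m2; elim: J uniqJ P sum0 => [_ | j J IH] /=.
  move=> P sum0; rewrite -[RHS](sum0 (fun=> 0) (fun=> 0))%N.
  by apply: eq_big => t; rewrite ?andbT ?big_nil ?mulr1.
case/andP=> jJ /IH {}IH P sum0; under eq_bigl => t do rewrite andbA.
apply: IH => n r z; have := vanishing_coef_conj (rho0 j); apply.
(* Only coordinate [j] moves; the product over [J] is frozen and absorbed into the coefficient. *)
move=> n0 r0 zj; pose upd (f : I -> nat) x i := if i == j then x else f i.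
rewrite -[RHS](sum0 (upd n n0) (upd r r0)); apply: eq_bigr => t _.
rewrite big_cons -mulrA [in LHS](mulrC (\prod_(i <- J) _)) /upd eqxx.
congr (_ * (_ * _)).
apply: eq_big_seq => i iJ; suff /negPf -> : i != j by [].
by apply: contraNneq jJ => <-.
Qed.

(** As [S] has no repetition, fixing all exponents of z and of conj z leaves the single term
    [h a a']. *)
Lemma conj_form_eq0 (I : finType) (rho : I -> C) (S : seq {ffun I -> nat})
    (h : {ffun I -> nat} -> {ffun I -> nat} -> C) :
  (forall i, rho i != 0) -> uniq S ->
  (forall n r (z := fun i => halfplane_point (rho i) (n i) (r i)),
     \sum_(a <- S) \sum_(a' <- S)
       h a a' * (\prod_i z i ^+ a i * (\prod_i z i ^+ a' i)^*) = 0) ->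
  {in S &, forall a a', h a a' = 0}.
Proof.
move=> rho0 uniqS sum0 a a' aS a'S.
pose s := [seq (b, b') | b <- S, b' <- S].
have uniqs : uniq s by apply: allpairs_uniq => // -[? ?] [? ?].
have aa's : (a, a') \in s by apply: allpairs_f.
pose e1 (t : {ffun I -> nat} * {ffun I -> nat}) := t.1 : I -> nat.
pose e2 (t : {ffun I -> nat} * {ffun I -> nat}) := t.2 : I -> nat.
have := @vanishing_coef_conj_prod I rho _ s e1 e2 (index_enum I) predT
  (fun t => h t.1 t.2) rho0 (index_enum_uniq I).
move=> /(_ _ a a') <-; last first.
  move=> n r z; rewrite big_allpairs -[RHS](sum0 n r).
  apply: eq_bigr => b _; apply: eq_bigr => b' _.
  rewrite big_split rmorph_prod; congr (_ * (_ * _)).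
  by apply: eq_bigr => i _; exact/esym/rmorphXn.
rewrite (eq_bigl (pred1 (a, a'))) => [|[b b'] /=].
  by rewrite -big_filter filter_pred1_uniq // big_seq1.
apply/allP/eqP => [eqs | [-> ->] i _]; last by rewrite !eqxx.
by congr pair; apply/ffunP => i;
  case/andP: (eqs i (mem_index_enum i)) => /eqP ? /eqP ?.
Qed.

End ConjugatePolynomials.

(** * Coefficients of polynomials with nonnegative roots *)

(** Signs alternate: multiplying by X - z with z > 0 adds terms of equal sign, so nothing
    cancels. *)
Lemma coef_prod_pos_roots (F : numDomainType) (r : seq F) n :
  all (> 0) r -> (n <= size r)%N ->
  0 < (-1) ^+ (n + size r) * (\prod_(z <- r) ('X - z%:P))`_n.
Proof.
elim: r n => [|z r IH] n /=.
  by rewrite leqn0 big_nil => _ /eqP->; rewrite coef1 mulr1 ltr01.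
case/andP=> z0 /IH {}IH n_le; set q := \prod_(z <- r) _ in IH *.
have size_q : size q = (size r).+1 by rewrite size_prod_XsubC.
rewrite big_cons mulrBl coefB coefXM coefCM addnS exprS mulN1r -/q.
case: n n_le => [_ | n]; first by rewrite sub0r mulrNN mulrCA mulr_gt0 ?IH.
rewrite ltnS /= => n_le; rewrite addSn exprS mulN1r opprK mulrBr.
rewrite ltr_wpDr ?IH //; move: n_le; rewrite leq_eqVlt => /predU1P [->|n_lt].
  by rewrite [q`__]nth_default ?size_q // !mulr0 oppr0.
by rewrite mulrCA -mulrN -mulNr -mulN1r -exprS -addSn mulr_ge0 ?ltW ?IH.
Qed.

(** The roots are in fact positive, so p is its leading coefficient times a real polynomial q, and
    p_0 * conj p_n = |lead p|^2 q_0 q_n. *)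
Lemma coef_nonneg_roots (F : numClosedFieldType) (p : {poly F}) :
  p`_0 != 0 -> (forall x, root p x -> 0 <= x) ->
  forall n, (n < size p)%N -> p`_n != 0 /\ p`_0 * (p`_n)^* \is Num.real.
Proof.
move=> p0 roots_ge0; have [r def_p] := closed_field_poly_normal p.
set q := \prod_(z <- r) _ in def_p; pose l := lead_coef p.
have l0 : l != 0 by rewrite lead_coef_eq0; apply: contraNneq p0 => ->; rewrite coef0.
have r_gt0 : all (> 0) r.
  apply/allP => z zr; have pz : root p z.
    by rewrite rootE def_p hornerZ mulf_eq0 -!rootE root_prod_XsubC zr orbT.
  rewrite lt_def roots_ge0 // andbT; apply: contraNneq p0 => z0.
  by move: pz; rewrite z0 rootE horner_coef0.
have size_p : size p = (size r).+1 by rewrite def_p size_scale // size_prod_XsubC.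
have q_real n : (n <= size r)%N -> q`_n != 0 /\ q`_n \is Num.real.
  move=> /(coef_prod_pos_roots r_gt0) q_gt0; split.
    by apply: contraTneq q_gt0 => ->; rewrite mulr0 ltxx.
  rewrite -[q`_n](signrMK (n + size r)) rpredMsign; exact: gtr0_real.
move=> n; rewrite size_p ltnS => n_le; have [qn0 qn_real] := q_real n n_le.
have [_ q0_real] := q_real 0 (leq0n _).
rewrite def_p !coefZ mulf_neq0 //; split=> //.
by rewrite rmorphM /= mulrACA (CrealP qn_real) -normCK !rpredM ?rpredX ?normr_real.
Qed.

(** * Determinants of matrices with positive definite imaginary part *)

Section DeterminantValues.
Context (R : realType).
Notation C := R[i].

(* By simultaneous diagonalization these are, for n > 0, exactly the     *)
(* determinants of n x n symmetric matrices with positive definite imaginary  *)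
(* part; only the inclusion given by diagonal matrices is needed.             *)
Definition upper_product n (x : C) : Prop :=
  exists2 w : 'I_n -> C, forall l, 0 < complex.Im (w l) & x = \prod_l w l.

Lemma upper_productS n (w x : C) :
  0 < complex.Im w -> upper_product n x -> upper_product n.+1 (w * x).
Proof.
move=> w_gt0 [v v_gt0 ->].
exists (fun l => oapp v w (unlift ord0 l)) => [l|]; first by case: unlift => /=.
rewrite big_ord_recl unlift_none; congr (_ * _).
by apply: eq_bigr => l _; rewrite liftK.
Qed.

Lemma upper_product0 : upper_product 0 1.
Proof. by exists (fun=> 1) => [[]|] //; rewrite big_ord0. Qed.

Lemma upper_product_iX n : upper_product n ('i%C ^+ n).
Proof.
elim: n => [|n IH]; first exact: upper_product0.
by rewrite exprS; apply: upper_productS IH; rewrite ltr01.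
Qed.

Lemma upper_product_halfplane n (m r : nat) : (0 < n)%N ->
  upper_product n (halfplane_point ('i%C ^+ n.-1) m r).
Proof.
case: n => // n _; rewrite /halfplane_point mulrC.
apply: upper_productS (upper_product_iX n).
rewrite mulr_natl [complex.Im _](raddfMn (@complex.Im R : Rcomplex R -> R)) /=.
by rewrite pmulrn_lgt0 ?ltr01.
Qed.

(** A square root of x is not real, hence it or its opposite lies in the upper half plane and serves
    as both factors. *)
Lemma upper_product2 (x : C) : ~~ (0 <= x) -> upper_product 2 x.
Proof.
move=> x_nneg; have sqr (y : C) : 0 < complex.Im y -> upper_product 2 (y ^+ 2).
  move=> y_gt0; rewrite expr2 -{2}[y]mulr1.
  exact/upper_productS/upper_productS/upper_product0.
rewrite -(sqr_sqrtc x) in x_nneg *.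
have [Im_lt0|/sqr//|Im0] := ltgtP (complex.Im (sqrtc x)) 0.
  by rewrite -sqrrN; apply: sqr; rewrite raddfN /= oppr_gt0.
case: (sqrtc x) Im0 x_nneg => a b /= ->.
by rewrite -[(a +i* 0)%C]/(real_complex _ a) -rmorphXn ler0c sqr_ge0.
Qed.

(* At most one of t / 'i and t / (1 + 'i) can be a nonnegative real; the      *)
(* other is then a product of two points of the upper half plane.             *)
Lemma upper_product_ge3 n (x : C) : (2 < n)%N -> x != 0 -> upper_product n x.
Proof.
case: n => [|[|[|n]]] // _ x0.
pose u : C := 'i%C; pose v : C := (1 +i* 1)%C; pose t := x / u ^+ n.
have u0 : u != 0 by rewrite eq_complex /= oner_eq0 andbF.
have prodE (w : C) : w != 0 -> ~~ (0 <= t / w) -> 0 < complex.Im w ->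
    upper_product n.+3 x.
  move=> w0 /upper_product2 [y y_gt0 def_y] w_gt0.
  have -> : x = y ord0 * (y ord_max * (w * u ^+ n)).
    rewrite !mulrA -[x](divfK (expf_neq0 n u0)) -/t; congr (_ * _).
    by rewrite -[t](divfK w0) def_y big_ord_recl big_ord1; congr (_ * y _ * _);
       apply/val_inj.
  by do 3![apply: upper_productS => //]; apply: upper_product_iX.
have v0 : v != 0 by rewrite eq_complex /= oner_eq0.
have t0 : t != 0 by rewrite mulf_neq0 // invr_eq0 expf_neq0.
have [tu_ge0|] := boolP (0 <= t / u); last by move/prodE; apply; rewrite //= ltr01.
apply: (prodE v); rewrite ?ltr01 //; apply/negP => tv_ge0.
have tv0 : t / v != 0 by rewrite mulf_neq0 ?invr_eq0.
have : 0 <= (t / u) / (t / v) by rewrite divr_ge0.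
have -> : (t / u) / (t / v) = (1 -i* 1)%C.
  have -> : (t / u) / (t / v) = v / u by field; rewrite u0 v0 t0.
  apply: (mulIf u0); rewrite divfK //; apply/eqP.
  by rewrite eq_complex /=; apply/andP; split; apply/eqP; lra.
by rewrite lecE /= oppr_eq0 oner_eq0.
Qed.

(** Evaluate at diagonal blocks listing the factors of each [x i]; a nonzero product has a nonzero
    second factor, which discards det(Z)^gamma. *)
Lemma psd_stable_neq0 k (d : 'I_k -> nat) (gamma : {ffun 'I_k -> nat})
    (B : {fset {ffun 'I_k -> nat}}) (c : {ffun 'I_k -> nat} -> C) :
  psd_stable (det_poly d gamma B c) ->
  forall x : 'I_k -> C, (forall i, upper_product (d i) (x i)) ->
    \sum_(b <- B) c b * \prod_i x i ^+ b i != 0.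
Proof.
move=> f_stable x.
pose Q i (w : 'I_(d i) -> C) :=
  (forall l, 0 < complex.Im (w l)) /\ x i = \prod_l w l.
move=> upper_x; have /fin_all_exists [w wP] : forall i, exists w, @Q i w.
  by move=> i; case: (upper_x i) => w ? ?; exists w.
pose M i : 'M[C]_(d i) := diag_mx (\row_l w i l).
have symM i : (M i)^T = M i by apply: tr_diag_mx.
have detM i : \det (M i) = x i.
  rewrite det_diag; case: (wP i) => _ ->; apply: eq_bigr => l _.
  by rewrite mxE.
have {f_stable} := f_stable M; rewrite eval_det_poly //.
under [X in _ * X]eq_bigr => b _ do under eq_bigr => i _ do rewrite detM.
rewrite mulf_eq0 negb_or; move=> /(_ _ _)/andP[] //.
  by rewrite tr_mxdiag; apply: eq_mxdiag.
apply: posdefmx_diag.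
  apply/is_diag_mxP => s t st.
  have /is_diag_mxP/(_ s t st) Mst0 : is_diag_mx (\mxdiag_i M i).
    apply/is_diag_mxblockP; split=> [i j /negPf->// | i].
    by rewrite eqxx conform_mx_id diag_mx_is_diag.
  by rewrite mxE Mst0.
move=> s; rewrite !mxE eqxx conform_mx_id !mxE eqxx.
by have [w_gt0 _] := wP (tagnat.sig1 s); apply: w_gt0.
Qed.

End DeterminantValues.

(** * The reduced sum as a polynomial in one determinant *)

Section Slices.
Context (F : fieldType) (k : nat) (B : {fset {ffun 'I_k -> nat}}).
Context (c : {ffun 'I_k -> nat} -> F) (i : 'I_k).

Definition with_exp (a : {ffun 'I_k -> nat}) (n : nat) : {ffun 'I_k -> nat} :=
  [ffun j => if j == i then n else a j].

(** Extension by zero lets the slices of all degrees be sums over the same [slice_exps], hence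
    comparable term by term. *)
Definition coef_on (b : {ffun 'I_k -> nat}) : F := if b \in B then c b else 0.

Definition slice_exps : seq {ffun 'I_k -> nat} := undup [seq with_exp b 0 | b <- B].

Definition slice (z : 'I_k -> F) (n : nat) : F :=
  \sum_(a <- slice_exps) coef_on (with_exp a n) * \prod_j z j ^+ a j.

Definition slice_poly (z : 'I_k -> F) : {poly F} :=
  \sum_(b <- B) (c b * \prod_j z j ^+ with_exp b 0 j) *: 'X^(b i).

Lemma with_exp_with_exp a m n : with_exp (with_exp a m) n = with_exp a n.
Proof. by apply/ffunP => j; rewrite !ffunE; case: eqP. Qed.

Lemma with_exp_id a : with_exp a (a i) = a.
Proof. by apply/ffunP => j; rewrite !ffunE; case: eqP => [->|]. Qed.

Lemma with_exp_at a n : with_exp a n i = n.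
Proof. by rewrite ffunE eqxx. Qed.

Lemma with_exp_slice_exps b : b \in B -> with_exp b 0 \in slice_exps.
Proof. by move=> bB; rewrite mem_undup; apply/mapP; exists b. Qed.

Lemma slice_exps0 a : a \in slice_exps -> with_exp a 0 = a.
Proof. by rewrite mem_undup => /mapP [b _ ->]; rewrite with_exp_with_exp. Qed.

Lemma horner_slice_poly z x :
  (slice_poly z).[x] =
  \sum_(b <- B) c b * \prod_j (if j == i then x else z j) ^+ b j.
Proof.
rewrite horner_sum; apply: eq_bigr => b _; rewrite hornerZ hornerXn -mulrA.
congr (_ * _); rewrite (bigD1 i) // [RHS](bigD1 i) //= with_exp_at eqxx mul1r.
rewrite mulrC; congr (_ * _).
by apply: eq_bigr => j /negPf ji; rewrite ffunE ji.
Qed.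

Lemma coef_slice_poly z n : (slice_poly z)`_n = slice z n.
Proof.
rewrite coef_sum; under eq_bigr => b _ do rewrite coefZ coefXn mulr_natr mulrb.
rewrite -big_mkcond /=.
rewrite -big_filter.
(* Elements of [B] with i-th exponent n correspond to their vectors with that exponent reset to
   0. *)
rewrite (perm_big [seq b <- [seq with_exp a n | a <- slice_exps] | b \in B]).
  rewrite big_filter big_map big_mkcond; apply: eq_big_seq => a aS /=.
  by rewrite /coef_on with_exp_with_exp slice_exps0 //; case: ifP; rewrite ?mul0r.
apply: uniq_perm => [||b]; rewrite ?filter_uniq ?fset_uniq //.
  rewrite map_inj_in_uniq ?undup_uniq // => a a' aS a'S /(congr1 (with_exp^~ 0%N)).
  by rewrite !with_exp_with_exp !slice_exps0.
rewrite !mem_filter andbC; apply: andb_id2l => bB.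
apply/eqP/mapP => [->|[a _ ->]]; last by rewrite with_exp_at.
exists (with_exp b 0); first exact: with_exp_slice_exps.
by rewrite with_exp_with_exp with_exp_id.
Qed.

End Slices.

(** * Consequences of stability for the slices *)

Section StableSlices.
Context (R : realType) (k : nat) (d : 'I_k -> nat).
Context (gamma : {ffun 'I_k -> nat}) (B : {fset {ffun 'I_k -> nat}}).
Context (c : {ffun 'I_k -> nat} -> R[i]) (i : 'I_k).
Notation C := R[i].

(* The j-th coordinate is realized by det diag(u, 'i, ..., 'i), whence the    *)
(* rotation by a power of 'i.                                                 *)
Definition det_point (n r : 'I_k -> nat) (j : 'I_k) : C :=
  halfplane_point ('i%C ^+ (d j).-1) (n j) (r j).

Lemma slice_mul_conj (z : 'I_k -> C) m n :
  slice B c i z m * (slice B c i z n)^* =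
  \sum_(a <- slice_exps B i) \sum_(a' <- slice_exps B i)
    coef_on B c (with_exp i a m) * (coef_on B c (with_exp i a' n))^* *
      (\prod_j z j ^+ a j * (\prod_j z j ^+ a' j)^*).
Proof.
rewrite big_distrl; apply: eq_bigr => a _ /=.
rewrite rmorph_sum big_distrr; apply: eq_bigr => a' _ /=.
by rewrite rmorphM mulrACA.
Qed.

Lemma slice_form_eq0 (h : {ffun 'I_k -> nat} -> {ffun 'I_k -> nat} -> C) :
  (forall n r (z := det_point n r),
     \sum_(a <- slice_exps B i) \sum_(a' <- slice_exps B i)
       h a a' * (\prod_j z j ^+ a j * (\prod_j z j ^+ a' j)^*) = 0) ->
  {in slice_exps B i &, forall a a', h a a' = 0}.
Proof.
apply: conj_form_eq0; last exact: undup_uniq.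
by move=> j; rewrite expf_neq0 // eq_complex /= oner_eq0 andbF.
Qed.

Lemma slice_mul_conj_eq0 (b b' : {ffun 'I_k -> nat}) : b \in B -> b' \in B ->
  (forall n r (z := det_point n r),
     slice B c i z (b i) * (slice B c i z (b' i))^* = 0) ->
  c b * (c b')^* = 0.
Proof.
move=> bB b'B prod0.
have := slice_form_eq0 (fun n r => etrans (esym (slice_mul_conj _ _ _)) (prod0 n r)).
move=> /(_ _ _ (with_exp_slice_exps i bB) (with_exp_slice_exps i b'B)).
by rewrite !with_exp_with_exp !with_exp_id /coef_on bB b'B.
Qed.

Lemma root_slice_poly n r x :
  (forall j, (0 < d j)%N) -> psd_stable (det_poly d gamma B c) ->
  root (slice_poly B c i (det_point n r)) x -> ~ upper_product (d i) x.
Proof.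
move=> d_gt0 f_stable; rewrite rootE horner_slice_poly => f0 upper_x.
pose y j := if j == i then x else det_point n r j.
apply: (negP (psd_stable_neq0 f_stable (x := y) _)) f0.
by move=> j; rewrite /y; case: eqP => [->//|_]; apply: upper_product_halfplane.
Qed.

Lemma block_size_le2 :
  (forall j, (0 < d j)%N) -> standard_form B c ->
  psd_stable (det_poly d gamma B c) ->
  (exists2 b, b \in B & (0 < b i)%N) -> (d i <= 2)%N.
Proof.
move=> d_gt0 [c_neq0 B_min] f_stable [b1 b1B b1i].
rewrite leqNgt; apply/negP => d_gt2; have [b0 b0B b0i] := B_min i.
suff /eqP : c b0 * (c b1)^* = 0.
  by apply/negP; rewrite mulf_neq0 ?conjC_eq0 ?c_neq0.
(* If both slices were nonzero at z, the polynomial in x would be nonconstant with a nonzero root, a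
   value that a block of size at least 3 attains. *)
apply: slice_mul_conj_eq0 => // n r z; rewrite b0i.
apply/eqP; rewrite mulf_eq0 conjC_eq0; apply/norP => -[].
rewrite -!coef_slice_poly => p0 pn.
have /closed_rootP [x px] : size (slice_poly B c i z) != 1%N.
  by apply: contraNneq pn => size1; rewrite nth_default ?size1.
apply: (root_slice_poly d_gt0 f_stable px); apply: upper_product_ge3 => //.
by apply: contraNneq p0 => x0; move: px; rewrite x0 rootE horner_coef0.
Qed.

Section SizeTwo.
Context (d_gt0 : forall j, (0 < d j)%N) (f_std : standard_form B c).
Context (f_stable : psd_stable (det_poly d gamma B c)) (di2 : d i = 2%N).

Lemma slice_coef n r l (z := det_point n r) :
  slice B c i z 0 != 0 -> (l < size (slice_poly B c i z))%N ->
  slice B c i z l != 0 /\ slice B c i z 0 * (slice B c i z l)^* \is Num.real.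
Proof.
rewrite -!coef_slice_poly => p0; apply: coef_nonneg_roots => // x px.
apply/negPn/negP => /upper_product2; rewrite -di2.
exact: root_slice_poly d_gt0 f_stable px.
Qed.

Lemma slice_real n r l (z := det_point n r) :
  slice B c i z 0 * (slice B c i z l)^* \is Num.real.
Proof.
have [->|p0] := eqVneq (slice B c i z 0) 0; first by rewrite mul0r rpred0.
have [/(slice_coef p0)[]//|] := ltnP l (size (slice_poly B c i z)).
move=> /leq_sizeP/(_ l (leqnn l)); rewrite coef_slice_poly => ->.
by rewrite conjC0 mulr0 rpred0.
Qed.

Let coef a n := coef_on B c (with_exp i a n).

(** Compare coefficients in F_0 * conj F_l = F_l * conj F_0, which expresses that the left side is
    real. *)
Lemma slice_coef_proportional l : {in slice_exps B i &, forall a a',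
  coef a 0 * (coef a' l)^* = (coef a' 0)^* * coef a l}.
Proof.
move=> a a' aS a'S; apply/eqP; rewrite -subr_eq0; apply/eqP; move: a a' aS a'S.
apply: slice_form_eq0 => n r z; set S := slice_exps B i.
pose form a a' := \prod_j z j ^+ a j * (\prod_j z j ^+ a' j)^*.
have -> : \sum_(a <- S) \sum_(a' <- S)
    (coef a 0 * (coef a' l)^* - (coef a' 0)^* * coef a l) * form a a' =
    slice B c i z 0 * (slice B c i z l)^* - slice B c i z l * (slice B c i z 0)^*.
  rewrite !slice_mul_conj -sumrB; apply: eq_bigr => a _.
  rewrite -sumrB; apply: eq_bigr => a' _.
  by rewrite mulrBl [(coef a' 0)^* * _]mulrC.
have /CrealP := slice_real n r l; rewrite -/z rmorphM /= conjCK mulrC => ->.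
by rewrite subrr.
Qed.

Lemma with_exp_mem b bN l :
  b \in B -> bN \in B -> (l <= bN i)%N -> with_exp i b l \in B.
Proof.
have [c_neq0 B_min] := f_std; have [b0 b0B b0i] := B_min i => bB bNB l_le.
set N := bN i in l_le.
have coef_neq0 b' n : b' \in B -> coef (with_exp i b' n) (b' i) != 0.
  by move=> b'B; rewrite /coef with_exp_with_exp with_exp_id /coef_on b'B c_neq0.
have a0S := with_exp_slice_exps i b0B; set a0 := with_exp i b0 0 in a0S.
have coef_a0 : coef a0 0%N != 0 by rewrite -b0i coef_neq0.
(* The ratio F_n / F_0, read off from the proportionality relation with second exponent [a0]. *)
pose lambda n := (coef a0 n)^* / (coef a0 0)^*.
have coefE n a : a \in slice_exps B i -> coef a n = lambda n * coef a 0.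
  move=> aS; apply: (mulfI (x := (coef a0 0)^*)); rewrite ?conjC_eq0 //.
  rewrite -slice_coef_proportional // mulrA [_ * lambda n]mulrC.
  by rewrite divfK ?conjC_eq0 // mulrC.
have sliceE z n : slice B c i z n = lambda n * slice B c i z 0.
  by rewrite big_distrr; apply: eq_big_seq => a aS /=; rewrite mulrA -coefE.
have lambdaN : lambda N != 0.
  have := coef_neq0 _ 0%N bNB.
  by rewrite coefE ?with_exp_slice_exps // mulf_eq0 => /norP[].
(* If it were 0, then F_l = 0; wherever F_0 is nonzero, l must exceed the degree, so F_N = 0 as N >=
   l, against [lambdaN]. Hence F_0 vanishes on the whole grid, forcing |c_b0|^2 = 0. *)
have lambda_l : lambda l != 0.
  apply: contraTneq (c_neq0 b0 b0B) => lambda0; rewrite negbK.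
  suff /eqP : c b0 * (c b0)^* = 0 by rewrite mulf_eq0 conjC_eq0 orbb.
  apply: slice_mul_conj_eq0 => // n r z; rewrite b0i.
  apply/eqP; rewrite mulf_eq0 conjC_eq0 orbb; apply: contraTT lambdaN => p0.
  have [/(slice_coef p0)[]|] := ltnP l (size (slice_poly B c i z)).
    by rewrite sliceE lambda0 mul0r eqxx.
  move=> /leq_sizeP/(_ N l_le)/eqP.
  by rewrite coef_slice_poly sliceE mulf_eq0 (negPf p0) orbF negbK.
have bS := with_exp_slice_exps i bB.
have : coef (with_exp i b 0) l != 0.
  rewrite coefE // mulf_neq0 //; have := coef_neq0 _ 0%N bB.
  by rewrite coefE // mulf_eq0 => /norP[].
by rewrite /coef with_exp_with_exp /coef_on; case: ifP => // _; rewrite eqxx.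
Qed.

End SizeTwo.
End StableSlices.

Theorem theorem5p11 (R : realType) (k : nat) (d : 'I_k -> nat)
    (d_gt0 : forall i, (0 < d i)%N)
    (gamma : {ffun 'I_k -> nat}) (B : {fset {ffun 'I_k -> nat}})
    (c : {ffun 'I_k -> nat} -> R[i])
    (f_std : standard_form B c)
    (f_stable : psd_stable (det_poly d gamma B c)) :
  (forall i : 'I_k, (exists2 b, b \in B & (0 < b i)%N) -> (d i <= 2)%N) /\
  (forall i : 'I_k, d i = 2%N ->
   forall b, b \in B ->
   forall m : int,
     - (b i)%:Z <= m -> m <= (\max_(b' <- B) b' i)%N%:Z - (b i)%:Z ->
     exists2 b', b' \in B &
       forall j : 'I_k, (b' j)%:Z = (b j)%:Z + m * (j == i)%:Z).
Proof.
split=> i; first exact: (block_size_le2 d_gt0 f_std f_stable).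
move=> di2 b bB m m_ge m_le.
set N := (\max_(b' <- B) b' i)%N in m_le.
have [bN bNB bNi] : exists2 b', b' \in B & b' i = N.
  have B_gt0 : (0 < size B)%N by rewrite -has_predT; apply/hasP; exists b.
  rewrite /N big_tnth.
  have [|t ->] := bigop.eq_bigmax (fun t => tnth (in_tuple B) t i); last first.
    by exists (tnth (in_tuple B) t) => //; apply: mem_tnth.
  by rewrite card_ord.
have [l def_l l_le] : exists2 l : nat, l%:Z = (b i)%:Z + m & (l <= N)%N.
  by exists (absz ((b i)%:Z + m)%R); lia.
exists (with_exp i b l) => [|j].
  by apply: (with_exp_mem d_gt0 f_std f_stable di2 bB bNB); rewrite bNi.
by rewrite ffunE; case: eqP => [->|_]; rewrite ?mulr1 // mulr0 addr0.
Qed.
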